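(* Fix an integer $n>2$. For $b\in\mathbb{Z}$ let $f_b(x)=x^n+bx+b$ and let $\theta_b$ be a root of $f_b$. Then there are infinitely many integers $b$ such that $f_b$ is irreducible and $\mathbb{Z}[\theta_b]$ is the full ring of integers of $\mathbb{Q}(\theta_b)$. Moreover, the natural density of the set of such $b$ is at least \[\frac{6}{\pi^2}-\left(1-\frac{6}{\pi^2}\prod_{p\mid (n-1)}\left(1-\frac{1}{p^2}\right)^{-1}\right)>21.58\%,\] where the product runs over primes $p$ dividing $n-1$.
   Context: For a set $A$ of integers, its natural density is $\lim_{x\to\infty}\#\{a\in A: a\le x\}/x$ (taken over the relevant counting of integers); ''density at least $\alpha$'' means this proportion is asymptotically at least $\alpha$. *)

(* Defs.v *)
From HB Require Import structures.
From mathcomp Require Import all_boot all_order all_algebra all_field.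
From mathcomp Require Import boolp reals trigo.
Set Implicit Arguments. Unset Strict Implicit. Unset Printing Implicit Defensive.
Import Order.TTheory GRing.Theory Num.Theory.
Local Open Scope ring_scope.

Definition fb (n : nat) (b : int) : {poly int} := 'X^n + b *: 'X + b%:P.

Definition in_Qadj (theta x : algC) : Prop :=
  exists p q : {poly rat},
    (map_poly ratr q).[theta] != 0 /\
    x = (map_poly ratr p).[theta] / (map_poly ratr q).[theta].

Definition in_Zadj (theta x : algC) : Prop :=
  exists p : {poly int}, x = (map_poly intr p).[theta].

Definition Ztheta_is_ring_of_integers (theta : algC) : Prop :=
  forall x : algC, (x \in Aint /\ in_Qadj theta x) <-> in_Zadj theta x.

Definition good (n : nat) (b : int) : Prop :=
  irreducible_poly (map_poly intr (fb n b) : {poly rat}) /\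
  forall theta : algC, root (map_poly intr (fb n b)) theta ->
    Ztheta_is_ring_of_integers theta.

Definition count_sym (P : int -> Prop) (N : nat) : nat :=
  (\sum_(i < (2 * N).+1) nat_of_bool (asbool (P (Posz i - Posz N)%R)))%N.

Definition lower_density_ge (R : realType) (P : int -> Prop) (alpha : R) : Prop :=
  forall eps : R, 0 < eps -> exists N0 : nat, forall N : nat, (N0 <= N)%N ->
    alpha - eps <= (count_sym P N)%:R / ((2 * N).+1)%:R.

Definition density_bound (R : realType) (n : nat) : R :=
  6 / pi ^+ 2 -
  (1 - 6 / pi ^+ 2 * \prod_(p <- primes n.-1) (1 - 1 / (p%:R ^+ 2))^-1).

(* Main.v *)
Require Import Defs.
From HB Require Import structures.
From mathcomp Require Import all_boot all_order all_algebra all_field.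
From mathcomp Require Import boolp reals trigo.
From mathcomp Require Import classical_sets topology normedtype sequences derive.
From mathcomp Require Import ring lra zify.
Import Order.TTheory GRing.Theory Num.Theory.
Import numFieldNormedType.Exports.
Local Open Scope ring_scope.
Set Implicit Arguments.
Unset Strict Implicit.
Unset Printing Implicit Defensive.

(** Up to sign and a power of [b], the discriminant of [x^n + b x + b] is
    [D = (-n)^n - b (n-1)^(n-1)].  If [b] and [D] are squarefree and [|b| > 1],
    the polynomial is Eisenstein, and Dedekind's criterion holds at every prime
    [p]: a repeated factor mod [p] must be [x] when [p] divides [b], and
    [(n-1) x + n] otherwise, so a failure at [p] would put [p^2] in [b] or in
    [D].  Both [b] and [D] are linear forms in [b]; a linear form [A + M b] with
    [A], [M] coprime is squarefree with lower density at least the product of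
    [1 - p^-2] over the primes not dividing [M]: sieve by finitely many primes
    and bound the contribution of the larger ones trivially.  The Euler product
    is bounded below through [sum k^-2 <= pi^2 / 6], which comes from iterating
    [sin^-2 y + cos^-2 y = 4 sin^-2 (2 y)] down from [y = pi / 4]. *)

(** * Dedekind's criterion and the polynomials [x^n + b x + b] *)

Local Notation pC := (map_poly (intr : int -> algC)).
Local Notation pQ := (map_poly (intr : int -> rat)).
Local Notation pF p := (map_poly (intr : int -> 'F_p)).

Lemma exists_irreducible_dvdp (F : fieldType) (k : {poly F}) :
  (1 < size k)%N -> exists2 q : {poly F}, irreducible_poly q & q %| k.
Proof.
have [m] := ubnP (size k); elim: m k => // m IHm k; rewrite ltnS => km k1.
have [irr|nirr] := pselect (irreducible_poly k); first by exists k.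
have [q [q1 qk nqk]] : exists q : {poly F}, [/\ size q != 1%N, q %| k & ~~ (q %= k)].
  apply: contrapT => none; apply: nirr; split => // q q1 qk.
  by apply: contrapT => /negP nqk; apply: none; exists q.
have k0 : k != 0 by rewrite -size_poly_gt0 ltnW.
have q0 : q != 0 by apply: contraTneq qk => ->; rewrite dvd0p.
have qltk : (size q < size k)%N.
  by rewrite ltn_neqAle dvdp_leq // andbT; apply: contraNneq nqk => eqs;
     rewrite -(dvdp_size_eqp qk) eqs.
have [||r irr rq] := IHm q; first exact: leq_trans qltk km.
  by rewrite ltn_neqAle eq_sym q1 size_poly_gt0.
by exists r => //; exact: dvdp_trans rq qk.
Qed.

Lemma irreducible_dvdpX (F : fieldType) (q h : {poly F}) m :
  irreducible_poly q -> q %| h ^+ m -> q %| h.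
Proof.
move=> irr; apply: contraLR => nqh.
rewrite -(irreducible_poly_coprime _ irr) in nqh.
rewrite -(irreducible_poly_coprime _ irr).
exact: coprimep_expr.
Qed.

(** Division by the monic [f] stays in Z[x]. The remainder vanishes at [theta], whose minimal
    polynomial over Q is associated to [f], so its degree forces it to be 0. *)
Lemma root_irreducible_dvd (f g : {poly int}) (theta : algC) :
    f \is monic -> irreducible_poly (pQ f) -> root (pC f) theta ->
    (pC g).[theta] = 0 -> exists T, g = f * T.
Proof.
move=> monf irr rf g0.
have pCE (h : {poly int}) : pC h = map_poly ratr (pQ h).
  by rewrite -map_poly_comp; apply: eq_map_poly => z /=; rewrite ratr_int.
have fE := Pdiv.RingMonic.rdivp_eq monf g.
set q := Pdiv.Ring.rdivp _ _ in fE; set r := Pdiv.Ring.rmodp _ _ in fE.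
suff r0 : r = 0 by exists q; rewrite [LHS]fE r0 addr0 mulrC.
apply/eqP; apply: contraT => rn0.
have rr : root (pC r) theta.
  move: g0; rewrite fE rmorphD rmorphM /= hornerD hornerM (rootP rf) mulr0 add0r.
  by move/rootP.
have [p [pE _] pdvd] := minCpolyP theta.
move: rf rr; rewrite !pCE !pdvd => pf pr.
have ps : size p != 1%N.
  have := size_minCpoly theta; rewrite pE size_map_poly.
  by case: (size p) => [|[]].
have := eqp_size (irr.2 _ ps pf); have := dvdp_leq _ pr.
rewrite !size_map_inj_poly //; try exact: intr_inj.
rewrite map_poly_eq0_id0 ?intr_eq0 ?lead_coef_eq0 // => /(_ rn0) + psf.
have : (size r < size f)%N by rewrite Pdiv.Ring.ltn_rmodp monic_neq0.
by rewrite psf ltnNge => /negP.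
Qed.

(* Clear denominators in a monic equation for [alpha]. *)
Lemma Aint_fraction_power (f b g : {poly int}) (theta alpha : algC) :
    f \is monic -> irreducible_poly (pQ f) -> root (pC f) theta ->
    alpha \in Aint -> (pC b).[theta] * alpha = (pC g).[theta] ->
  exists m T S, g ^+ m = f * T + b * S.
Proof.
move=> monf irr rf; rewrite unfold_in => /floorpP[P PE] bg.
have monP : P \is monic.
  have := minCpoly_monic alpha; rewrite PE !monicE lead_coef_map_inj //;
    last exact: intr_inj.
  by rewrite (eqr_int _ _ 1).
have rP : (pC P).[alpha] = 0 by rewrite -PE; apply/rootP/root_minCpoly.
have sP : size P = (size P).-1.+1.
  by rewrite prednK // size_poly_gt0 monic_neq0.
set m := (size P).-1 in sP.
(* The homogenized equation [b^m P(g / b)]: it vanishes at [theta] and equals [g^m] modulo [b]. *)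
pose Q := \sum_(i < m.+1) P`_i *: (b ^+ (m - i) * g ^+ i).
have Q0 : (pC Q).[theta] = 0.
  rewrite -(mulr0 ((pC b).[theta] ^+ m)) -rP.
  rewrite raddf_sum /= horner_sum (@horner_coef_wide _ m.+1 (pC P)); last first.
    by rewrite size_map_inj_poly ?sP //; exact: intr_inj.
  rewrite mulr_sumr; apply: eq_bigr => i _.
  rewrite map_polyZ /= hornerZ rmorphM /= !rmorphXn /= hornerM !horner_exp.
  rewrite coef_map /= -bg exprMn [RHS]mulrCA; congr (_ * _).
  by rewrite mulrA -exprD subnK // -ltnS.
have [T QT] := root_irreducible_dvd monf irr rf Q0.
exists m, T, (- \sum_(i < m) P`_i *: (b ^+ (m - i).-1 * g ^+ i)).
rewrite -QT /Q big_ord_recr /= subnn expr0 mul1r.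
rewrite -lead_coefE (monicP monP) scale1r mulrN mulr_sumr addrAC -sumrB big1 ?add0r // => i _.
rewrite -scalerAr mulrA -exprS prednK ?subrr // subn_gt0 //.
Qed.

Lemma reduction_surj p (h : {poly 'F_p}) : prime p -> exists H, pF p H = h.
Proof.
move=> pp; exists (map_poly (fun x : 'F_p => (nat_of_ord x)%:Z) h).
apply: map_polyK => // x; exact: natr_Zp.
Qed.

Lemma reduction_eq0 p (G : {poly int}) : prime p -> pF p G = 0 ->
  exists S, G = p%:Z%:P * S.
Proof.
move=> pp G0; exists (map_poly (fun c => (c %/ p)%Z) G).
apply/polyP => i; rewrite coefCM coef_map_id0 ?div0z //.
rewrite mulrC divzK // (dvdz_pcharf (pchar_Fp pp)).
by rewrite -(coef_map intr) G0 coef0.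
Qed.

(* Dedekind's criterion.  Modulo [p], put [h = gcd(G, f)] and [k = f / h], with
   lifts [H] and [K].  Then [H(theta) / p] is integral; clearing denominators in
   its monic equation by [p], respectively by [K(theta)], shows that every prime
   factor of [k] divides [h], respectively [r]. *)
Lemma dedekind_witness (f G : {poly int}) (theta : algC) p :
    f \is monic -> irreducible_poly (pQ f) -> root (pC f) theta -> prime p ->
    (pC G).[theta] / p%:R \in Aint -> ~~ (pF p f %| pF p G) ->
  exists (q : {poly 'F_p}) (H K r : {poly int}),
    [/\ irreducible_poly q, f = H * K - p%:Z%:P * r,
        q %| pF p H, q %| pF p K & q %| pF p r].
Proof.
move=> monf irr rf pp GA nfG.
have p0 : (p%:R : algC) != 0 by rewrite pnatr_eq0 -lt0n prime_gt0.
have pC_p : pC p%:Z%:P = p%:R%:P :> {poly algC} by rewrite map_polyC.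
have pF_p : pF p p%:Z%:P = 0.
  rewrite map_polyC /=; have /eqP -> : p%:Z%:~R == 0 :> 'F_p; last by [].
  by rewrite -(dvdz_pcharf (pchar_Fp pp)) dvdzz.
have monF : pF p f \is monic by exact: monic_map.
set h := gcdp (pF p G) (pF p f).
pose k := pF p f %/ h.
have khE : k * h = pF p f by apply: divpK; exact: dvdp_gcdr.
have k0 : k != 0.
  by apply: contra_neq (monic_neq0 monF) => kz; rewrite -khE kz mul0r.
have k1 : (1 < size k)%N.
  rewrite ltn_neqAle size_poly_gt0 k0 andbT eq_sym; apply: contra nfG.
  move=> /size_poly1P[c c0 kc]; apply: (dvdp_trans _ (dvdp_gcdl _ (pF p f))).
  by rewrite -/h -khE kc mul_polyC dvdpZl.
have [q irrq qk] := exists_irreducible_dvdp k1.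
have [H HE] := reduction_surj h pp.
have [K KE] := reduction_surj k pp.
have [r rE] : exists r, H * K - f = p%:Z%:P * r.
  by apply: reduction_eq0 => //; rewrite rmorphB rmorphM /= HE KE mulrC khE subrr.
(* A Bezout relation mod [p], lifted to the integers: [H(theta) / p = U(theta) G(theta) / p +
   C(theta)] is then integral. *)
have [U [V [C HUV]]] : exists U V C, H = U * G + V * f + p%:Z%:P * C.
  have [[u v] /= /eqpP[[c1 c2] /= /andP[c10 c20] E]] := Bezoutp (pF p G) (pF p f).
  have [U UE] := reduction_surj ((c1 / c2) *: u) pp.
  have [V VE] := reduction_surj ((c1 / c2) *: v) pp.
  have [C CE] : exists C, H - (U * G + V * f) = p%:Z%:P * C.
    apply: reduction_eq0 => //; rewrite rmorphB rmorphD !rmorphM /= HE UE VE.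
    rewrite -!scalerAl -scalerDr mulrC -scalerA E scalerA mulVf //.
    by rewrite scale1r subrr.
  by exists U, V, C; rewrite -CE addrC subrK.
have f0 := rootP rf.
have HA : (pC H).[theta] / p%:R \in Aint.
  have evA (W : {poly int}) : (pC W).[theta] \in Aint.
    rewrite horner_coef; apply: rpred_sum => i _; apply: rpredM.
      by rewrite coef_map /= Aint_int.
    apply: rpredX; apply: (root_monic_Aint rf); first exact: monic_map.
    by apply/polyOverP => j; rewrite coef_map /= intr_int.
  rewrite HUV !rmorphD !rmorphM /= !hornerD !hornerM f0 mulr0 addr0.
  rewrite pC_p hornerC mulrDl -mulrA [p%:R * _]mulrC mulfK //.
  by apply: rpredD => //; apply: rpredM.
have qH : q %| pF p H.
  have [|m [T [S E]]] := Aint_fraction_power (b := p%:Z%:P) (g := H) monf irr rf HA.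
    by rewrite pC_p hornerC mulrC divfK.
  apply: (irreducible_dvdpX (m := m) irrq); rewrite -rmorphXn /= E rmorphD !rmorphM /=.
  by rewrite pF_p mul0r addr0 -khE -mulrA dvdp_mulr.
have qr : q %| pF p r.
  have [|m [T [S E]]] := Aint_fraction_power (b := K) (g := r) monf irr rf HA.
    apply: (mulIf p0); rewrite mulrA divfK //.
    move/(congr1 (fun W => (pC W).[theta])): rE.
    rewrite rmorphB !rmorphM /= hornerD hornerN !hornerM pC_p hornerC f0 subr0.
    by rewrite mulrC => ->; rewrite mulrC.
  apply: (irreducible_dvdpX (m := m) irrq); rewrite -rmorphXn /= E rmorphD !rmorphM /=.
  by rewrite KE -khE -mulrA -mulrDr dvdp_mulr.
exists q, H, K, r; split => //; last by rewrite KE.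
by rewrite -rE opprB addrC subrK.
Qed.

(* The denominator of an integral element is removed one prime at a time. *)
Lemma Ztheta_maximal (f : {poly int}) (theta : algC) :
    f \is monic -> irreducible_poly (pQ f) -> root (pC f) theta ->
    (forall p (q : {poly 'F_p}) (H K r : {poly int}), prime p ->
      irreducible_poly q -> f = H * K - p%:Z%:P * r ->
      q %| pF p H -> q %| pF p K -> q %| pF p r -> False) ->
  Ztheta_is_ring_of_integers theta.
Proof.
move=> monf irr rf noq.
have f0 := rootP rf.
have thA : theta \in Aint.
  apply: (root_monic_Aint rf); first exact: monic_map.
  by apply/polyOverP => j; rewrite coef_map /= intr_int.
have pCE (h : {poly int}) : pC h = map_poly ratr (pQ h).
  by rewrite -map_poly_comp; apply: eq_map_poly => z /=; rewrite ratr_int.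
have step (G : {poly int}) p : prime p -> (pC G).[theta] / p%:R \in Aint ->
    exists S : {poly int}, (pC G).[theta] = p%:R * (pC S).[theta].
  move=> pp GA; case: (boolP (pF p f %| pF p G)) => [|nfG].
    move=> /dvdpP[t tE]; have [T TE] := reduction_surj t pp.
    have [|S SE] := @reduction_eq0 p (G - T * f) pp.
      by rewrite rmorphB rmorphM /= TE tE subrr.
    exists S; move/(congr1 (fun W => (pC W).[theta])): SE.
    rewrite rmorphB !rmorphM /= hornerD hornerN !hornerM f0 mulr0 subr0 => ->.
    by rewrite map_polyC hornerC.
  have [q [H [K [r [irrq fE qH qK qr]]]]] :=
    dedekind_witness monf irr rf pp GA nfG.
  by case: (noq p q H K r).
have main d : (0 < d)%N -> forall G : {poly int}, (pC G).[theta] / d%:R \in Aint ->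
    in_Zadj theta ((pC G).[theta] / d%:R).
  elim/ltn_ind: d => d IHd d0 G GA.
  have [d1|d1] := leqP d 1.
    have -> : d = 1%N by apply/eqP; rewrite eqn_leq d1.
    by exists G; rewrite divr1.
  have [p pp /dvdnP[e dE]] : exists2 p, prime p & (p %| d)%N.
    by exists (pdiv d); [exact: pdiv_prime | exact: pdiv_dvd].
  have e0 : (0 < e)%N by case: e dE d0 => // ->.
  have ed : (e < d)%N by rewrite dE -[ltnLHS]muln1 ltn_pmul2l // prime_gt1.
  have p0 : (p%:R : algC) != 0 by rewrite pnatr_eq0 -lt0n prime_gt0.
  have e0' : (e%:R : algC) != 0 by rewrite pnatr_eq0 -lt0n.
  have [|S SE] := step G p pp.
    have -> : (pC G).[theta] / p%:R = (pC G).[theta] / d%:R * e%:R.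
      by rewrite dE natrM; field; rewrite p0 e0'.
    by rewrite rpredM // Aint_Cnat.
  have xE : (pC G).[theta] / d%:R = (pC S).[theta] / e%:R.
    by rewrite SE dE natrM; field; rewrite p0 e0'.
  by rewrite xE; apply: IHd => //; rewrite -xE.
move=> x; split; last first.
  case=> g ->; split.
    rewrite horner_coef; apply: rpred_sum => i _; apply: rpredM.
      by rewrite coef_map /= Aint_int.
    exact: rpredX.
  exists (pQ g), 1; rewrite -pCE rmorph1 hornerC divr1; split => //.
  exact: oner_neq0.
case=> xA [g [q [q0 xE]]].
(* As [q(theta)] is nonzero, [f] does not divide [q], and Bezout turns [1 / q(theta)] into a
   polynomial in [theta]. *)
have cop : coprimep (pQ f) q.
  rewrite irreducible_poly_coprime //; apply: contra q0 => /dvdpP[t ->].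
  by rewrite rmorphM /= -pCE hornerM f0 mulr0.
have [[u v] /= uv] := Bezout_eq1_coprimepP _ _ cop.
have vq : (map_poly ratr v).[theta] * (map_poly ratr q).[theta] = 1 :> algC.
  move/(congr1 (fun W => (map_poly (ratr : rat -> algC) W).[theta])): uv.
  by rewrite rmorphD !rmorphM /= rmorph1 hornerD !hornerM -pCE f0 mulr0 add0r hornerC.
have {}xE : x = (map_poly ratr (g * v)).[theta].
  by rewrite xE rmorphM hornerM; apply: (mulIf q0); rewrite divfK // -mulrA vq mulr1.
have [G [a a0 gE]] := rat_poly_scale (g * v).
move: xE; rewrite gE map_polyZ /= -pCE hornerZ fmorphV /= ratr_int => xE.
wlog ap : G a a0 {gE} xE / 0 < a.
  move=> wl; have [an|ap|az] := ltgtP a 0; [|exact: (wl G a)|by rewrite az eqxx in a0].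
  apply: (wl (- G) (- a)); rewrite ?oppr_eq0 ?oppr_gt0 //.
  by rewrite xE !rmorphN /= hornerN invrN mulrNN.
have {}xE : x = (pC G).[theta] / (absz a)%:R.
  by rewrite xE mulrC natr_absz gtr0_norm.
by rewrite xE; apply: main; rewrite ?absz_gt0 // -xE.
Qed.

(** * Irreducibility and maximality for [x^n + b x + b] *)

Lemma size_fb_tail n (b : int) : (2 < n)%N ->
  (size (b *: 'X + b%:P)%R < size ('X^n : {poly int}))%N.
Proof.
move=> n2; rewrite size_polyXn; apply: leq_ltn_trans (size_polyD _ _) _.
rewrite gtn_max; apply/andP; split.
  by apply: leq_ltn_trans (size_scale_leq _ _) _; rewrite size_polyX; lia.
by apply: leq_ltn_trans (size_polyC_leq1 _) _; lia.
Qed.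

Lemma fb_monic n b : (2 < n)%N -> fb n b \is monic.
Proof.
by move=> n2; rewrite monicE /fb -addrA lead_coefDl ?lead_coefXn ?size_fb_tail.
Qed.

Lemma size_fb n b : (2 < n)%N -> size (fb n b) = n.+1.
Proof.
by move=> n2; rewrite /fb -addrA size_polyDl ?size_fb_tail // size_polyXn.
Qed.

Definition int_squarefree (b : int) :=
  forall p : nat, prime p -> ~~ ((p ^ 2)%:Z %| b)%Z.

(** Eisenstein at the smallest prime factor of [b], which divides the constant term exactly once. *)
Lemma fb_irreducible n b : (2 < n)%N -> (1 < `|b|)%N -> int_squarefree b ->
  irreducible_poly (pQ (fb n b)).
Proof.
move=> n2 b1 sqb; apply/irreducible_rat_int.
have pp := pdiv_prime b1.
have pb : ((pdiv `|b|)%:Z %| b)%Z by rewrite dvdzE /= pdiv_dvd.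
apply: (eisenstein_crit pp).
- by rewrite size_fb //; case: n n2.
- rewrite (monicP (fb_monic _ n2)) dvdzE /= dvdn1.
  by rewrite neq_ltn (prime_gt1 pp) orbT.
- rewrite /fb !coefD coefXn coefZ coefX coefC /= mulr0 addr0.
  by case: n n2 => // n _; rewrite add0r; exact: (sqb _ pp).
- move=> i; rewrite size_fb //= => ltin.
  rewrite /fb !coefD coefXn coefZ coefX coefC (ltn_eqF ltin) add0r.
  by rewrite rpredD //; [apply: dvdz_mulr | case: ifP => // _; rewrite dvdz0].
Qed.

Definition fb_disc (n : nat) (b : int) : int :=
  (- n%:Z) ^+ n - b * (n.-1)%:Z ^+ n.-1.

(** Such a [q] must be some [x - c] mod [p]; then [p] divides [H(c)], [K(c)] and [r(c)], so [p^2]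
    divides [f(c)]. If [p] divides [b], take [c = 0], where [f(0) = b]. Otherwise take
    [c = -n / (n-1)] mod [p^2], where [(n-1)^n f(c)] is congruent to [fb_disc n b]. *)
Lemma fb_no_dedekind_witness n b p (q : {poly 'F_p}) (H K r : {poly int}) :
  (2 < n)%N -> int_squarefree b -> int_squarefree (fb_disc n b) -> prime p ->
  irreducible_poly q -> fb n b = H * K - p%:Z%:P * r ->
  q %| pF p H -> q %| pF p K -> q %| pF p r -> False.
Proof.
move=> n2 sqb sqD pp irrq fE qH qK qr.
have inF := dvdz_pcharf (pchar_Fp pp).
have pF_p : pF p p%:Z%:P = 0.
  rewrite map_polyC /=; have /eqP -> : p%:Z%:~R == 0 :> 'F_p; last by [].
  by rewrite -inF dvdzz.
have linear (c : int) : q %| 'X - (c%:~R)%:P -> ((p ^ 2)%:Z %| (fb n b).[c])%Z.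
  move=> qc; have ev (W : {poly int}) : q %| pF p W -> (p%:Z %| W.[c])%Z.
    move=> qW; rewrite inF -horner_map /=; apply/eqP/rootP.
    rewrite root_factor_theorem; apply: dvdp_trans qW.
    have : q %= 'X - (c%:~R)%:P.
      apply: (irredp_XsubC _).2 qc; by rewrite neq_ltn irrq.1 orbT.
    by rewrite eqp_sym => /andP[].
  rewrite fE hornerD hornerN !hornerM hornerC -mulnn PoszM.
  by rewrite rpredB // dvdz_mul // ?dvdzz // ev.
have fpE : pF p (fb n b) = 'X^n + b%:~R *: 'X + (b%:~R)%:P.
  by rewrite /fb !rmorphD /= map_polyZ map_polyXn map_polyX map_polyC.
have qf : q %| pF p (fb n b).
  by rewrite fE rmorphB !rmorphM /= pF_p mul0r subr0 dvdp_mulr.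
case: (boolP (p%:Z %| b)%Z) => [pb|npb].
  have := sqb p pp; apply/negP; rewrite negbK.
  have -> : b = (fb n b).[0].
    by rewrite /fb !hornerE; case: n n2 {sqD fE fpE qf linear} => // n _; rewrite expr0n add0r.
  apply: linear; rewrite subr0.
  move: pb qf; rewrite inF fpE => /eqP ->; rewrite scale0r !addr0.
  exact: irreducible_dvdpX.
have qf' : q %| (pF p (fb n b))^`().
  rewrite fE rmorphB !rmorphM /= pF_p mul0r subr0 derivM.
  by rewrite dvdp_add //; [apply: dvdp_mull | apply: dvdp_mulr].
have qlin : q %| (n.-1)%:R *: 'X + (n%:R)%:P.
  have b0 : b%:~R != 0 :> 'F_p by rewrite -inF.
  rewrite -(dvdpZr _ _ b0).
  (* The combination [n f - x f'] cancels [x^n]. *)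
  have -> : b%:~R *: ((n.-1)%:R *: 'X + (n%:R)%:P) =
     n%:R *: pF p (fb n b) - 'X * (pF p (fb n b))^`().
    rewrite fpE !derivD derivXn derivZ derivX derivC.
    rewrite -!mul_polyC.
    case: n n2 {sqD fE fpE qf linear qf'} => // m _ /=.
    rewrite -[X in 'X * (X + _ + _)]mulr_natr exprS -(addn1 m) !natrD !rmorphD !rmorph_nat /=.
    ring.
  by rewrite dvdp_sub // -?mul_polyC dvdp_mull.
(* If [p] divided [n-1], the linear polynomial would reduce to the constant 1. *)
have pn1 : (n.-1)%:Z%:~R != 0 :> 'F_p.
  apply/eqP => n10; have nE : n%:R = 1 :> 'F_p.
    by rewrite -(ltn_predK n2) -natr1 [_%:R]n10 add0r.
  move: qlin; rewrite [_%:R]n10 scale0r add0r nE dvdp1.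
  by apply/negP; rewrite neq_ltn irrq.1 orbT.
have cop : coprimez (p ^ 2)%:Z (n.-1)%:Z.
  by rewrite coprimezE /= coprimeXl // prime_coprime //; move: pn1; rewrite -inF dvdzE.
have [[u v] /= uv] := coprimezP _ _ cop.
(* Since [v] inverts [n-1] mod [p^2], this [c] is a root of [(n-1) x + n] mod [p^2] and not only mod
   [p]. *)
pose c := - n%:Z * v; pose w := (n.-1)%:Z * c + n%:Z.
have wp : ((p ^ 2)%:Z %| w)%Z.
  have -> : w = n%:Z * u * (p ^ 2)%:Z.
    have -> : w = n%:Z * 1 - n%:Z * v * (n.-1)%:Z by rewrite /w /c; ring.
    by rewrite -uv; ring.
  exact: dvdz_mull.
have pw : (p%:Z %| w)%Z by apply: dvdz_trans wp; rewrite -mulnn PoszM dvdz_mulr.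
have qc : q %| 'X - (c%:~R)%:P.
  rewrite -(dvdpZr _ _ pn1); move: pw; rewrite inF => /eqP w0.
  have -> : (n.-1)%:Z%:~R *: ('X - (c%:~R)%:P) =
            (n.-1)%:R *: 'X + (n%:R)%:P - (w%:~R)%:P :> {poly 'F_p}.
    rewrite /w rmorphD rmorphM /= -!mul_polyC !rmorphD !rmorphM /=; ring.
  by rewrite w0 subr0.
have := sqD p pp; apply/negP; rewrite negbK.
have -> : fb_disc n b = (n.-1)%:Z ^+ n * (fb n b).[c] -
   ((w - n%:Z) ^+ n - (- n%:Z) ^+ n + b * (n.-1)%:Z ^+ n.-1 * w).
  have -> : w - n%:Z = (n.-1)%:Z * c by rewrite /w; ring.
  rewrite /w; clear wp pw qc w; clearbody c.
  rewrite /fb_disc /fb !hornerE exprMn.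
  case: n n2 {sqD fE fpE qf linear qf' pn1 qlin cop uv} => // m _ /=.
  rewrite !exprS -(addn1 m) PoszD; ring.
rewrite rpredB // ?dvdz_mull ?linear // rpredD //; last exact: dvdz_mull.
by rewrite subrXX dvdz_mulr // opprK subrK.
Qed.

Lemma good_of_squarefree n b : (2 < n)%N -> (1 < `|b|)%N ->
  int_squarefree b -> int_squarefree (fb_disc n b) -> good n b.
Proof.
move=> n2 b1 sqb sqD; split; first exact: fb_irreducible.
move=> theta rt; apply: (Ztheta_maximal (fb_monic b n2)) => //.
  exact: fb_irreducible.
by move=> p q H K r; apply: fb_no_dedekind_witness.
Qed.

(** * The upper bounds for [pi] and for the sum of inverse squares *)

(* [1486 / 473] is a fraction with small denominator below [sqrt (12 / 1.2158)];
   the Taylor polynomial of [cos] of degree 8 is already negative at its half. *)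
Lemma pi_lt (R : realType) : pi < 1486 / 473 :> R.
Proof.
rewrite ltNge; apply/negP => pi_ge; pose c : R := 743 / 473.
have : 0 <= cos c by apply: cos_ge0_pihalf; rewrite /c; lra.
apply/negP; rewrite -ltNge -(opprK (cos c)) oppr_lt0.
have /cvgN h := @cvg_cos_coeff' R c.
rewrite -(cvg_lim (@Rhausdorff R) h).
apply: (@lt_trans _ _ (\sum_(0 <= i < 5) - cos_coeff' c i)).
  rewrite !big_nat_recr //= big_nil /cos_coeff' -!exprnP !factS fact0 !natrM /c.
  rewrite !exprSr !expr0; lra.
rewrite -seriesN lt_sum_lim_series //.
  by move/cvgP in h; rewrite seriesN.
(* The remaining terms of [- cos c] are taken in consecutive pairs: the first has odd index, hence
   is positive, and it dominates the second because [c^2 < 25]. *)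
move=> d; rewrite /cos_coeff' -!exprnP.
set n := (5 + d.*2)%N; have -> : (5 + d.*2.+1 = n.+1)%N by rewrite /n addnS.
have odd_n : odd n by rewrite /n oddD odd_double.
have n_ge5 : (5 <= n)%N by rewrite /n leq_addr.
have sgn_n : (-1) ^+ n = -1 :> R by rewrite -signr_odd odd_n.
clearbody n; rewrite exprS sgn_n mulrNN mulr1 mulN1r mul1r mulNr opprK.
rewrite doubleS !exprSr !factS !natrM.
have x0 : 0 < c ^+ n.*2 by rewrite exprn_gt0 // /c; lra.
have f0 : 0 < (n.*2`!%:R : R) by rewrite ltr0n fact_gt0.
rewrite subr_gt0 ltr_pdivrMr; last by rewrite !mulr_gt0 ?ltr0n ?fact_gt0.
rewrite -!mulrA ltr_pM2l // [ltRHS]mulrC -!mulrA mulfV ?gt_eqF // mulr1.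
have n5 : (5 : R) <= n.*2.+1%:R by rewrite ler_nat; lia.
have n6 : (5 : R) <= n.*2.+2%:R by rewrite ler_nat; lia.
by apply: (@lt_le_trans _ _ (5 * 5)); [rewrite /c; lra | rewrite ler_pM].
Qed.

Lemma sin_le_id (R : realType) (x : R) : 0 < x -> sin x <= x.
Proof.
move=> x0; have [|c _] := @MVT R sin cos 0 x x0.
  by apply: continuous_subspaceT => y; exact: continuous_sin.
rewrite sin0 !subr0 => ->; rewrite -[leRHS]mul1r ler_pM2r //; exact: cos_le1.
Qed.

Lemma inv_sin2_half (R : realType) (y : R) : sin y != 0 -> cos y != 0 ->
  sin y ^- 2 + cos y ^- 2 = 4 * sin (y *+ 2) ^- 2.
Proof.
move=> s0 c0; rewrite sin_mulr2n.
have e := cos2Dsin2 y.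
have -> : sin y ^- 2 + cos y ^- 2 = (cos y ^+ 2 + sin y ^+ 2) / (cos y ^+ 2 * sin y ^+ 2).
  by field; rewrite s0 c0.
rewrite e; field; by rewrite s0 c0.
Qed.

(** Level 0 is [pi / 4]; for [k < 2^n] on each level [n], the next level consists of the halves [y]
    of these angles and their complements [pi / 2 - y]. *)
Definition dyadic_angle (R : realType) n k : R := (k.*2.+1)%:R * pi / 2 ^+ n.+2.

Lemma dyadic_angle_bounds (R : realType) n k : (k < 2 ^ n)%N ->
  0 < dyadic_angle R n k < pi / 2.
Proof.
move=> kn; have p0 := pi_gt0 R.
have t0 : 0 < 2 ^+ n.+2 :> R by rewrite exprn_gt0.
apply/andP; split; first by rewrite divr_gt0 // mulr_gt0 // ltr0n.
rewrite /dyadic_angle ltr_pdivrMr // mulrAC ltr_pdivlMr // mulrC mulrA [ltRHS]mulrC.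
rewrite ltr_pM2r // -natrX -natrM ltr_nat !expnS; lia.
Qed.

(** Each level multiplies the sum by 4: an angle [y] and its complement, whose sine is [cos y],
    together contribute [4 sin^-2 (2 y)]. *)
Lemma sum_inv_sin2 (R : realType) n :
  \sum_(0 <= k < 2 ^ n) sin (dyadic_angle R n k) ^- 2 = 2 * 4 ^+ n.
Proof.
have p0 := pi_gt0 R.
elim: n => [|n IHn].
  rewrite big_nat1 /dyadic_angle mul1r expr0 mulr1.
  have := @inv_sin2_half R (pi / 2 ^+ 2).
  have -> : pi / 2 ^+ 2 *+ 2 = pi / 2 :> R by rewrite -mulr_natr; field.
  have -> : cos (pi / 2 ^+ 2) = sin (pi / 2 ^+ 2) :> R.
    by rewrite -[in LHS](opprK (pi / _)) cosN -sinDpihalf; congr sin; field.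
  rewrite sin_pihalf.
  have s0 : sin (pi / 2 ^+ 2) != 0 :> R.
    by rewrite gt_eqF // sin_gt0_pihalf //; apply/andP; split; lra.
  move=> /(_ s0 s0); rewrite expr1n invr1; lra.
rewrite exprS mulrCA -{}IHn mulr_sumr expnS mul2n -addnn.
rewrite (@big_cat_nat _ _ _ (2 ^ n)) ?leq_addr //=.
rewrite -{2}[(2 ^ n)%N]add0n big_addn addnK.
(* Reversing the upper half puts the complement of the angle [k] at index [k]. *)
rewrite [X in _ + X]big_nat_rev -big_split /=.
rewrite big_nat [RHS]big_nat; apply: eq_bigr => k /= kn.
have [s0 c0] : sin (dyadic_angle R n.+1 k) != 0 /\ cos (dyadic_angle R n.+1 k) != 0.
  have /andP[a0 ap] : 0 < dyadic_angle R n.+1 k < pi / 2.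
    by apply: dyadic_angle_bounds; rewrite expnS; lia.
  split; first by rewrite gt_eqF // sin_gt0_pihalf // a0.
  by rewrite gt_eqF // cos_gt0_pihalf //; apply/andP; split => //; lra.
have t0 : 2 ^+ n != 0 :> R by rewrite gt_eqF // exprn_gt0.
have -> : dyadic_angle R n k = dyadic_angle R n.+1 k *+ 2.
  by rewrite /dyadic_angle -mulr_natr !exprS; field.
rewrite -inv_sin2_half //; congr (_ + _ ^- 2).
rewrite -[in RHS](opprK (dyadic_angle _ _ _)) cosN -sinDpihalf; congr sin.
have -> : (0 + 2 ^ n - k.+1 + 2 ^ n = 2 ^ n.+1 - k.+1)%N by rewrite expnS; lia.
rewrite /dyadic_angle.
have -> : ((2 ^ n.+1 - k.+1).*2.+1)%:R = 2 ^+ n.+2 - (k.*2.+1)%:R :> R.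
  by rewrite -natrX -natrB ?expnS; [congr _%:R|]; rewrite ?expnS; lia.
by rewrite !exprS; field.
Qed.

(** Since [sin x <= x], each [x^-2] is at most [sin^-2 x]; this is summed over the dyadic angles and
    rescaled. *)
Lemma sum_odd_inv_sqr_le (R : realType) n :
  \sum_(0 <= k < 2 ^ n) (k.*2.+1%:R ^- 2 : R) <= pi ^+ 2 / 8.
Proof.
have p0 := pi_gt0 R.
have t0 : 0 < 4 ^+ n :> R by rewrite exprn_gt0.
rewrite -(@ler_pM2l _ (16 * 4 ^+ n / pi ^+ 2)); last first.
  by rewrite divr_gt0 ?mulr_gt0 ?exprn_gt0.
have -> : 16 * 4 ^+ n / pi ^+ 2 * (pi ^+ 2 / 8) = 2 * 4 ^+ n :> R.
  by move: (pi : R) p0 => P P0; field; rewrite gt_eqF.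
rewrite -sum_inv_sin2 mulr_sumr big_nat [leRHS]big_nat; apply: ler_sum => k /= kn.
have /andP[a0 ap] := @dyadic_angle_bounds R n k kn.
have -> : 16 * 4 ^+ n / pi ^+ 2 * k.*2.+1%:R ^- 2 = dyadic_angle R n k ^- 2.
  have -> : 4 ^+ n = (2 ^+ n) ^+ 2 :> R.
    have -> : 4 = 2 ^+ 2 :> R by ring.
    by rewrite -!exprM mulnC.
  rewrite /dyadic_angle !exprS; move: (pi : R) p0 => P P0; field.
  by rewrite nat1r pnatr_eq0 !gt_eqF // exprn_gt0.
have s0 : 0 < sin (dyadic_angle R n k) by rewrite sin_gt0_pihalf // a0.
rewrite lef_pV2 ?posrE ?exprn_gt0 // ler_pXn2r ?nnegrE //; try exact: ltW.
exact: sin_le_id.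
Qed.

(** Separating odd and even terms, [S (2 m)] is the odd sum plus [S m / 4]. With [S m <= S (2 m)]
    this bounds [3/4 S m] by [pi^2 / 8] at [m = 2^N]. *)
Lemma sum_inv_sqr_le (R : realType) N :
  \sum_(0 <= k < N) (k.+1%:R ^- 2 : R) <= pi ^+ 2 / 6.
Proof.
pose S n := \sum_(0 <= k < n) (k.+1%:R ^- 2 : R).
have Smono m n : (m <= n)%N -> S m <= S n.
  move=> mn; rewrite /S (@big_cat_nat _ _ _ m 0 n) //= lerDl.
  by apply: sumr_ge0 => k _; rewrite invr_ge0 exprn_ge0.
have Sdouble m : S m.*2 = \sum_(0 <= k < m) (k.*2.+1%:R ^- 2 : R) + S m / 4.
  elim: m => [|m IHm]; first by rewrite /S !big_geq // mul0r addr0.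
  rewrite doubleS {1}/S !big_nat_recr //= -/(S _) IHm /S big_nat_recr //= -/(S _).
  have -> : (m.*2.+2%:R : R) = 2 * m.+1%:R by rewrite -natrM; congr _%:R; lia.
  have m0 : (m.+1%:R : R) != 0 by rewrite pnatr_eq0.
  have m1 : (m.*2.+1%:R : R) != 0 by rewrite pnatr_eq0.
  by field; rewrite !nat1r m0 m1.
have := sum_odd_inv_sqr_le R N; have := Smono (2 ^ N)%N (2 ^ N).*2.
rewrite -addnn leq_addr addnn Sdouble => /(_ isT).
have := Smono N (2 ^ N)%N (ltnW (ltn_expl _ _)); rewrite -/(S _) => /(_ isT).
lra.
Qed.

(** * Squarefree values of linear forms *)

Definition sieve_density (R : realType) (S : seq nat) : R :=
  \prod_(p <- S) (1 - 1 / p%:R ^+ 2).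

(* The summand at [k = 0] vanishes because [0^-1 = 0]. *)
Definition coprime_zeta2 (R : realType) (S : seq nat) (N : nat) : R :=
  \sum_(0 <= k < N) (all (fun p => ~~ (p %| k)%N) S)%:R * k%:R ^- 2.

Lemma coprime_zeta2_mono (R : realType) S m n : (m <= n)%N ->
  coprime_zeta2 R S m <= coprime_zeta2 R S n.
Proof.
move=> mn; rewrite /coprime_zeta2 (@big_cat_nat _ _ _ m 0 n) //= lerDl.
by apply: sumr_ge0 => k _; rewrite mulr_ge0 ?ler0n // invr_ge0 exprn_ge0.
Qed.

Lemma coprime_zeta2_le (R : realType) S N : coprime_zeta2 R S N <= pi ^+ 2 / 6.
Proof.
case: N => [|N].
  by rewrite /coprime_zeta2 big_geq // divr_ge0 // exprn_ge0 // pi_ge0.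
apply: le_trans (sum_inv_sqr_le R N); rewrite /coprime_zeta2 big_nat_recl //.
rewrite expr0n /= invr0 mulr0 add0r; apply: ler_sum => k _.
by rewrite ler_piMl ?invr_ge0 ?exprn_ge0 // lern1 leq_b1.
Qed.

(** The indices [p j], with [j] prime to [S], contribute [j^-2 / p^2] and are disjoint from those
    prime to [p]; the range below [K + p J] contains both truncations. *)
Lemma coprime_zeta2_cons (R : realType) p S K J : prime p -> p \notin S -> all prime S ->
  coprime_zeta2 R (p :: S) K + coprime_zeta2 R S J / p%:R ^+ 2
    <= coprime_zeta2 R S (K + p * J).
Proof.
move=> pp pS prS.
pose g k : R := (p %| k)%:R * ((all (fun q => ~~ (q %| k)%N) S)%:R * k%:R ^- 2).
have g0 k : 0 <= g k by rewrite !mulr_ge0 ?ler0n // invr_ge0 exprn_ge0.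
have gmul : coprime_zeta2 R S J / p%:R ^+ 2 <= \sum_(0 <= k < p * J) g k.
  elim: J => [|J IHJ]; first by rewrite /coprime_zeta2 muln0 !big_geq ?mul0r.
  have lt1 : (p * J < p * J.+1)%N by rewrite ltn_pmul2l ?prime_gt0.
  rewrite (@big_cat_nat _ _ _ (p * J)) //=; last exact: ltnW.
  rewrite {1}/coprime_zeta2 big_nat_recr //= -/(coprime_zeta2 R S J) mulrDl.
  (* Of the block [p J <= k < p (J + 1)] only the first index is kept. *)
  apply: lerD => //; rewrite big_ltn // -[leLHS]addr0; apply: lerD; last first.
    by apply: sumr_ge0 => k _; exact: g0.
  have -> : g (p * J)%N = (all (fun q => ~~ (q %| p * J)%N) S)%:R *
                           (J%:R ^- 2 / p%:R ^+ 2).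
    by rewrite /g dvdn_mulr // mul1r natrM exprMn [(_ * _)^-1]invfM [_^-1 / _]mulrC.
  rewrite -mulrA.
  apply: ler_wpM2r; first by rewrite mulr_ge0 // invr_ge0 exprn_ge0.
  rewrite ler_nat; case: allP => //= SJ.
  suff -> : all (fun q => ~~ (q %| p * J)%N) S by [].
  apply/allP => q qS; have prq := allP prS q qS.
  rewrite Euclid_dvdM // negb_or SJ // andbT dvdn_prime2 //; apply/eqP => qp.
  by rewrite -qp qS in pS.
have split N : coprime_zeta2 R S N = coprime_zeta2 R (p :: S) N + \sum_(0 <= k < N) g k.
  rewrite /coprime_zeta2 -big_split /=; apply: eq_bigr => k _; rewrite /g.
  by case: (p %| k)%N; rewrite /= ?mul0r ?add0r ?addr0 ?mul1r.
rewrite [leRHS]split; apply: lerD; first by rewrite coprime_zeta2_mono ?leq_addr.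
apply: (le_trans gmul); rewrite (@big_cat_nat _ _ _ (p * J) 0 (K + _)) ?leq_addl //= lerDl.
by apply: sumr_ge0 => k _; exact: g0.
Qed.

(* Finite form of the Euler product: after passing to suprema, removing the
   multiples of [p] from the series multiplies its sum by [1 - p^-2]. *)
Lemma sieve_density_ge (R : realType) S : uniq S -> all prime S ->
  6 / pi ^+ 2 <= sieve_density R S.
Proof.
pose z T : R := sup (range (coprime_zeta2 R T)).
have z_ub T N : coprime_zeta2 R T N <= z T.
  apply: ub_le_sup; last by exists N.
  by exists (pi ^+ 2 / 6) => _ [M _ <-]; exact: coprime_zeta2_le.
have z_le T U : (forall N, coprime_zeta2 R T N <= U) -> z T <= U.
  move=> h; apply: ge_sup; first by exists (coprime_zeta2 R T 0), 0%N.
  by move=> _ [M _ <-].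
have z_sieve : uniq S -> all prime S -> z S <= sieve_density R S * (pi ^+ 2 / 6).
  elim: S => [_ _|p S IHS /= /andP[pS uS] /andP[pp prS]].
    by rewrite /sieve_density big_nil mul1r; apply: (z_le) => N; exact: coprime_zeta2_le.
  have p0 : 0 < p%:R :> R by rewrite ltr0n prime_gt0.
  have p1 : 1 <= p%:R ^+ 2 :> R by rewrite -natrX ler1n expn_gt0 prime_gt0.
  rewrite /sieve_density big_cons -/(sieve_density R S) -mulrA.
  apply: le_trans (_ : (1 - 1 / p%:R ^+ 2) * z S <= _); last first.
    by apply: ler_wpM2l (IHS uS prS); rewrite subr_ge0 div1r invf_le1 // exprn_gt0.
  apply: (z_le) => K.
  (* For fixed [K], the supremum over [J] is taken first. *)
  have : z S <= p%:R ^+ 2 * (z S - coprime_zeta2 R (p :: S) K).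
    apply: (z_le) => J; rewrite mulrC -ler_pdivrMr ?exprn_gt0 // lerBrDr addrC.
    exact: le_trans (coprime_zeta2_cons _ _ _ pp pS prS) (z_ub _ _).
  rewrite mulrC -ler_pdivrMr ?exprn_gt0 // mulrBl div1r mul1r; lra.
(* The term [k = 1] survives every prime, so [z S] is at least 1. *)
move=> uS prS; have := z_sieve uS prS; have := z_ub S 2%N.
rewrite /coprime_zeta2 !big_nat_recr //= big_geq // expr0n /= invr0 mulr0 !add0r.
rewrite expr1n invr1 mulr1.
have -> : all (fun p => ~~ (p %| 1)%N) S.
  apply/allP => p /(allP prS) /prime_gt1 p1; rewrite dvdn1; lia.
have p0 := pi_gt0 R; have P2 : 0 < pi ^+ 2 :> R by rewrite exprn_gt0.
rewrite ler_pdivrMr // => z1 zS; have {z1 zS} := le_trans z1 zS.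
by rewrite mulrA ler_pdivlMr //= mul1r.
Qed.

Lemma sieve_density_01 (R : realType) S : all prime S -> 0 <= sieve_density R S <= 1.
Proof.
elim: S => [|p S IHS] /=; first by rewrite /sieve_density big_nil ler01 lexx.
move=> /andP[pp /IHS /andP[h0 h1]]; rewrite /sieve_density big_cons -/(sieve_density R S).
have p0 : 0 < p%:R :> R by rewrite ltr0n prime_gt0.
have p1 : 1 <= p%:R ^+ 2 :> R by rewrite -natrX ler1n expn_gt0 prime_gt0.
have q0 : 0 <= 1 - 1 / p%:R ^+ 2 :> R by rewrite subr_ge0 div1r invf_le1 // exprn_gt0.
rewrite mulr_ge0 //= mulr_ile1 // gerBl div1r invr_ge0 exprn_ge0 //.
Qed.

(** The indices below [L] congruent to [r] are the [r + d k] with [k < t]; the bounds place their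
    number [t] within 1 of [L / d]. *)
Lemma sum_residue (d r : nat) (a : nat -> bool) L : (r < d)%N ->
  exists2 t, (L <= r + d * t < L + d)%N &
   (\sum_(0 <= i < L) ((i %% d == r) && a i) = \sum_(0 <= k < t) a (r + d * k))%N.
Proof.
move=> rd; elim: L => [|L [t /andP[tL tU] E]].
  by exists 0%N; [lia | rewrite !big_geq].
have [e|ne] := eqVneq L (r + d * t)%N.
  exists t.+1; first by rewrite mulnS; lia.
  have modE : (L %% d = r)%N by rewrite e addnC mulnC modnMDl modn_small.
  by rewrite !big_nat_recr //= E modE eqxx -e.
exists t; first by lia.
rewrite big_nat_recr //= E; case: eqP => [Lr|_]; last by rewrite addn0.
exfalso; have := divn_eq L d; rewrite Lr => LE.
have qt : (L %/ d < t)%N by rewrite -(@ltn_pmul2r d); lia.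
by have := leq_mul qt (leqnn d); rewrite mulSn; lia.
Qed.

(** The residue is [-A] times an inverse of [M] mod [d]. *)
Lemma residue_class (d : nat) (A M : int) : (0 < d)%N -> coprimez d M ->
  exists2 r : nat, (r < d)%N & forall i : nat, (d%:Z %| A + M * i%:Z)%Z = (i %% d == r)%N.
Proof.
move=> d0 cop; have [[u v] /= uv] := coprimezP _ _ cop.
have dz : d%:Z != 0 by lia.
have r0 := modz_ge0 (- A * v) dz; have rd := ltz_pmod (- A * v) (_ : 0 < d%:Z).
pose r := `|((- A * v) %% d)%Z|%N.
have rE : r%:Z = ((- A * v) %% d)%Z by rewrite /r gez0_abs.
exists r; first by rewrite -ltz_nat rE rd.
move=> i; have rlt : (r < d)%N by rewrite -ltz_nat rE rd.
rewrite -[X in _ == X](modn_small rlt) -eqz_nat -!modz_nat rE modz_mod eqz_mod_dvd.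
rewrite -[RHS](Gauss_dvdzr _ cop).
have -> : M * (i%:Z - - A * v) = A + M * i%:Z - A * u * d%:Z.
  have AE : A = A * u * d%:Z + A * v * M by rewrite -[LHS]mulr1 -uv; ring.
  by rewrite [X in X + M * _]AE; ring.
by rewrite rpredBr // dvdz_mull.
Qed.

Definition sieved (S : seq nat) (A M : int) (i : nat) : bool :=
  all (fun p => ~~ ((p ^ 2)%:Z %| A + M * i%:Z)%Z) S.

(* The indices where [p^2] divides the form are an arithmetic progression, on
   which the form is again linear, with leading coefficient [M p^2]. *)
Lemma sieve_count (R : realType) S : uniq S -> all prime S ->
  exists C : R, forall A M L, all (fun p => coprime p `|M|) S ->
   `|(\sum_(0 <= i < L) sieved S A M i)%N%:R - sieve_density R S * L%:R| <= C.
Proof.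
elim: S => [_ _|p S IHS /= /andP[pS uS] /andP[pp prS]].
  exists 0 => A M L _; rewrite /sieved /= /sieve_density big_nil mul1r.
  by rewrite sum_nat_const_nat subn0 muln1 subrr normr0.
(* One [C] comes from the whole range, one from the progression, and 1 from replacing its length [t]
   by [L / p^2]. *)
have [C hC] := IHS uS prS; exists (C + C + 1) => A M L /andP[pM SM].
have p20 : (0 < p ^ 2)%N by rewrite expn_gt0 prime_gt0.
have cop : coprimez (p ^ 2)%:Z M by rewrite coprimezE /= coprimeXl.
have [r rd rE] := residue_class A p20 cop.
have [t /andP[tL tU] tE] := sum_residue (sieved S A M) L rd.
have := hC A M L SM.
have := hC (A + M * r%:Z) (M * (p ^ 2)%:Z) t.
have -> : all (fun q => coprime q `|M * (p ^ 2)%:Z|) S.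
  apply/allP => q qS; have prq := allP prS q qS; have qM := allP SM q qS.
  rewrite abszM /= coprimeMr qM coprimeXr // prime_coprime // dvdn_prime2 //.
  by apply/eqP => qp; rewrite -qp qS in pS.
move=> /(_ isT).
have -> : (\sum_(0 <= i < t) sieved S (A + M * r%:Z) (M * (p ^ 2)%:Z) i =
           \sum_(0 <= i < t) sieved S A M (r + p ^ 2 * i))%N.
  apply: eq_bigr => i _; congr nat_of_bool; apply: eq_all => q.
  by rewrite PoszD PoszM mulrDr !addrA mulrA.
rewrite -tE.
set X := (\sum_(0 <= i < L) (_ && _))%N.
have -> : (\sum_(0 <= i < L) sieved S A M i = X + \sum_(0 <= i < L) sieved (p :: S) A M i)%N.
  rewrite /X -big_split /=; apply: eq_bigr => i _.
  by rewrite /sieved /= rE; case: (_ == r); rewrite /= ?addn0 ?add0n.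
rewrite natrD /sieve_density big_cons -/(sieve_density R S).
have /andP[] := sieve_density_01 R prS.
have {tL} : L%:R < p%:R ^+ 2 * (t%:R + 1) :> R.
  by rewrite -natrX natr1 -natrM ltr_nat; move: tL rd; rewrite mulnS; lia.
have {tU} : p%:R ^+ 2 * (t%:R - 1) < L%:R :> R.
  rewrite mulrBr mulr1 ltrBlDr -natrX -natrM -natrD ltr_nat; lia.
have : 0 < p%:R ^+ 2 :> R by rewrite exprn_gt0 // ltr0n prime_gt0.
move: (p%:R ^+ 2 : R) (sieve_density R S) => q D q0.
rewrite -ltr_pdivlMl // => h1; rewrite -ltr_pdivrMl // => h2 D0 D1.
rewrite !ler_norml => /andP[h3 h4] /andP[h5 h6].
have tL : -1 <= t%:R - q^-1 * L%:R <= 1 by apply/andP; split; lra.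
have : `|D * (t%:R - q^-1 * L%:R)| <= 1.
  by rewrite normrM (ger0_norm D0) mulr_ile1 // ler_norml tL.
rewrite ler_norml mulrBr mulrA => /andP[h7 h8].
have -> : (1 - 1 / q) * D * L%:R = D * L%:R - D / q * L%:R by rewrite div1r; ring.
by apply/andP; split; lra.
Qed.

Lemma square_divisor_count (R : realType) (d : nat) (A M : int) L :
  (0 < d)%N -> coprime d `|M| ->
  (\sum_(0 <= i < L) ((d ^ 2)%N%:Z %| (A + M * i%:Z)%R)%Z)%N%:R <= L%:R / d%:R ^+ 2 + 1 :> R.
Proof.
move=> d0 dM; have d20 : (0 < d ^ 2)%N by rewrite expn_gt0 d0.
have cop : coprimez (d ^ 2)%:Z M by rewrite coprimezE /= coprimeXl.
have [r rd rE] := residue_class A d20 cop.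
have [t /andP[tL tU] tE] := sum_residue predT L rd.
have -> : (\sum_(0 <= i < L) ((d ^ 2)%N%:Z %| (A + M * i%:Z)%R)%Z = t)%N.
  under eq_bigr => i _ do rewrite rE -[_ == r]andbT.
  by rewrite tE sum_nat_const_nat subn0 muln1.
have q0 : 0 < d%:R ^+ 2 :> R by rewrite exprn_gt0 // ltr0n.
rewrite -lerBlDr ler_pdivlMr // mulrBl mul1r lerBlDr -natrX -natrM -natrD ler_nat.
by rewrite mulnC; lia.
Qed.

(** Telescoping of [1 / d^2 <= 1 / (d-1) - 1 / d]. *)
Lemma sum_inv_sqr_tail (R : realType) (y T : nat) : (0 < y)%N ->
  \sum_(y.+1 <= d < T) (d%:R ^- 2 : R) <= y%:R^-1.
Proof.
move=> y0; have y0R : 0 < y%:R :> R by rewrite ltr0n.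
have [Ty|yT] := leqP T y.+1; first by rewrite big_geq // invr_ge0 ltW.
have -> : T = (y.+1 + (T - y.+1))%N by lia.
apply: (@le_trans _ _ (y%:R^-1 - (y + (T - y.+1))%:R^-1)); last first.
  by rewrite gerBl invr_ge0.
elim: (T - y.+1)%N => [|k IHk]; first by rewrite !addn0 big_geq // subrr.
rewrite addnS big_nat_recr ?leq_addr //=.
apply: le_trans (lerD IHk (lexx _)) _.
rewrite addSn addnS; have : 0 < (y + k)%:R :> R by rewrite ltr0n; lia.
rewrite -[(y + k).+1%:R]natr1; move: ((y + k)%:R : R) => a a0.
have -> : y%:R^-1 - (a + 1)^-1 = y%:R^-1 - a^-1 + 1 / (a * (a + 1)).
  by field; rewrite !gt_eqF //; lra.
have a1 : 0 < a + 1 by lra.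
rewrite lerD2l div1r lef_pV2 ?posrE ?mulr_gt0 // expr2 ler_wpM2r ?(ltW a1) //; lra.
Qed.

(** Adjoining the primes of [m] to [S] gives a list to which [sieve_density_ge] applies; their
    factors are then divided out. *)
Lemma sieve_density_away_ge (R : realType) (m : nat) S : uniq S -> all prime S ->
  all (fun p => p \notin primes m) S ->
  6 / pi ^+ 2 * \prod_(p <- primes m) (1 - 1 / (p%:R ^+ 2))^-1 <= sieve_density R S.
Proof.
move=> uS prS Sm; rewrite prodfV -/(sieve_density R (primes m)).
have prm : all prime (primes m) by apply/allP => p; rewrite mem_primes => /andP[].
rewrite ler_pdivrMr.
  rewrite /sieve_density -big_cat; apply: sieve_density_ge; last by rewrite all_cat prS.
  rewrite cat_uniq uS primes_uniq andbT /=; apply/hasPn => p pm.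
  by apply/negP => /(allP Sm); rewrite pm.
rewrite /sieve_density big_seq; apply: prodr_gt0 => p /(allP prm) /prime_gt1 p1.
have q1 : 1 < p%:R ^+ 2 :> R by rewrite -natrX ltr1n -(exp1n 2) ltn_exp2r.
by rewrite subr_gt0 div1r invf_lt1 // (lt_trans ltr01).
Qed.

(** Once [T] is of the order of [N], [T^2] exceeds the values of the form, so a nonzero value has no
    divisor [p^2] with [p >= T]. *)
Lemma linear_form_lt (A M : int) (y N T i : nat) :
  (`|A| + 2 * y * `|M| < T)%N -> (N <= 2 * y * T)%N -> (i < (2 * N).+1)%N ->
  (`|(A + M * (i%:Z - N%:Z))%R| < T ^ 2)%N.
Proof.
move=> hT NT iN; have {}iN : (`|(i%:Z - N%:Z)%R| <= N)%N by lia.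
have h1 : (`|(A + M * (i%:Z - N%:Z))%R| <= `|A| + `|M| * N)%N.
  apply: leq_trans (_ : (`|A| + `|(M * (i%:Z - N%:Z))%R| <= _)%N); first by lia.
  by rewrite abszM leq_add2l leq_mul2l iN orbT.
have h2 : (`|M| * N <= `|M| * (2 * y * T))%N by rewrite leq_mul2l NT orbT.
have h3 : ((`|A| + 2 * y * `|M|).+1 * T <= T * T)%N by rewrite leq_mul2r hT orbT.
have h4 : (`|A| <= `|A| * T)%N by rewrite leq_pmulr //; lia.
have e : (`|M| * (2 * y * T) = 2 * y * `|M| * T)%N by lia.
rewrite e in h2.
rewrite mulSn mulnDl in h3; rewrite -mulnn; apply: leq_ltn_trans h1 _.
move: h2 h3 h4 hT; move: (_ * N)%N (2 * y * `|M| * T)%N (_ * T)%N (T * T)%N.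
by move=> a b c d; lia.
Qed.

(** Three losses of [eps / 3] each: the error [C] of sieving by primes up to [y], the tail of
    [L / d^2] over [d > y], and a rounding error 1 for each of at most [T <= L / y] moduli. *)
Lemma squarefree_lower_density (R : realType) (A M : int) (m : nat) (eps : R) :
  M != 0 -> coprimez A M ->
  (forall p, prime p -> (p %| `|M|)%N = (p \in primes m)) -> 0 < eps ->
  exists N0, forall N, (N0 <= N)%N ->
   (6 / pi ^+ 2 * \prod_(p <- primes m) (1 - 1 / (p%:R ^+ 2))^-1 - eps)
     * (2 * N).+1%:R
   <= (\sum_(0 <= i < (2 * N).+1)
         asbool (int_squarefree (A + M * (i%:Z - N%:Z))%R))%N%:R :> R.
Proof.
move=> M0 cop Mm eps0.
have [y yeps] : exists y : nat, 3 / eps < y.+1%:R :> R.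
  exists (Num.truncn (3 / eps)).
  by have /andP[] := truncn_itv (ltW (divr_gt0 (ltr0Sn R 2) eps0)).
move: y.+1 (ltn0Sn y) yeps => {}y y0 yeps.
pose S := [seq p <- iota 0 y.+1 | prime p && (p \notin primes m)].
have uS : uniq S by rewrite filter_uniq ?iota_uniq.
have prS : all prime S by apply/allP => p; rewrite mem_filter => /andP[/andP[]].
have Sm : all (fun p => p \notin primes m) S.
  by apply/allP => p; rewrite mem_filter => /andP[/andP[]].
have SM : all (fun p => coprime p `|M|) S.
  apply/allP => p; rewrite mem_filter => /andP[/andP[pp pm] _].
  by rewrite prime_coprime // Mm.
have [C hC] := sieve_count R uS prS.
have Dge := sieve_density_away_ge R uS prS Sm.
have [K Keps] : exists K : nat, C * 3 / eps < K%:R :> R.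
  exists (Num.truncn `|C * 3 / eps|).+1.
  apply: le_lt_trans (ler_norm _) _.
  by have /andP[] := truncn_itv (normr_ge0 (C * 3 / eps)).
(* A prime not dividing [M], kept as the modulus for the value 0, which every square divides. *)
have [p0 yp0 pp0] := prime_above (y + `|M|).
pose T0 := (p0 + `|A| + 2 * y * `|M| + 1)%N.
exists (K + y * T0)%N => N hN.
set L := (2 * N).+1; pose T := (L %/ y)%N.
have yL : (y * T <= L)%N by rewrite mulnC leq_divM.
have TT0 : (T0 <= T)%N.
  rewrite leq_divRL // mulnC (leq_trans (leq_addl K _)) // (leq_trans hN) //.
  by rewrite /L mul2n -addnn ltnW // ltnS leq_addr.
have LT : (L < y * T.+1)%N by rewrite mulnC ltn_ceil.
have T1 : (0 < T)%N by apply: leq_trans TT0; rewrite /T0 addn1.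
have NT : (N <= 2 * y * T)%N.
  have : (y * T.+1 <= 2 * y * T)%N.
    by rewrite [(2 * y)%N]mulnC -mulnA leq_mul2l mul2n -addnn -add1n leq_add2r T1 orbT.
  apply: leq_trans; apply: leq_trans (ltnW LT).
  by rewrite /L mul2n -addnn ltnW // ltnS leq_addr.
have ATy : (`|A| + 2 * y * `|M| < T)%N.
  by apply: leq_trans TT0; rewrite /T0 addn1 ltnS -addnA leq_addl.
have zT i : (i < L)%N -> (`|(A + M * (i%:Z - N%:Z))%R| < T ^ 2)%N.
  by move=> iL; exact: linear_form_lt ATy NT iL.
(* An index that survives the sieve without a squarefree value is charged to some [d^2] with
   [y < d < T] and [d] coprime to [M]. *)
have pointwise i : (i < L)%N -> (sieved S (A - M * N%:Z)%R M i <=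
    asbool (int_squarefree (A + M * (i%:Z - N%:Z))%R) +
    \sum_(y.+1 <= d < T) (coprime d `|M| && ((d ^ 2)%N%:Z %| (A - M * N%:Z + M * i%:Z)%R)%Z))%N.
  move=> iL; have zE : A - M * N%:Z + M * i%:Z = A + M * (i%:Z - N%:Z) by ring.
  case: asboolP => [_|nsq]; first by rewrite (leq_trans (leq_b1 _)) ?leq_addr.
  rewrite add0n; case sv: (sieved _ _ _ i) => //=.
  have [p pp pz] : exists2 p, prime p & ((p ^ 2)%:Z %| A + M * (i%:Z - N%:Z))%Z.
    apply: contrapT => none; apply: nsq => p pp; apply/negP => pz.
    by apply: none; exists p.
  have pM : ~~ (p %| `|M|)%N.
    apply/negP => pM; have pMz : (p%:Z %| M)%Z by rewrite dvdzE.
    have pA : (p%:Z %| A)%Z.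
      rewrite -(rpredDr _ (dvdz_mulr (i%:Z - N%:Z) pMz)).
      by apply: dvdz_trans pz; rewrite -mulnn PoszM dvdz_mulr.
    have : (p %| gcdn `|A| `|M|)%N by rewrite dvdn_gcd pM andbT; rewrite dvdzE in pA.
    move: cop; rewrite coprimezE /coprime => /eqP ->; rewrite dvdn1 => /eqP p1.
    by rewrite p1 in pp.
  have [d [yd dT cd dz]] : exists d, [/\ (y < d)%N, (d < T)%N, coprime d `|M| &
      ((d ^ 2)%N%:Z %| (A - M * N%:Z + M * i%:Z)%R)%Z].
    have yp : (y < p)%N.
      rewrite ltnNge; apply/negP => py.
      have : p \in S by rewrite mem_filter pp -Mm // pM mem_iota.
      by move=> /(allP sv); rewrite zE pz.
    have [pT|Tp] := ltnP p T.
      by exists p; rewrite zE prime_coprime // pM.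
    have z0 : A + M * (i%:Z - N%:Z) = 0.
      apply/eqP; apply: contraT; rewrite -absz_gt0 => z0.
      have := zT i iL; rewrite ltnNge; case/negP.
      apply: leq_trans (_ : (p ^ 2 <= _)%N); first by rewrite leq_exp2r.
      by apply: dvdn_leq z0 _; rewrite dvdzE in pz.
    exists p0; rewrite zE z0 dvdz0; split => //.
    - by apply: leq_ltn_trans yp0; rewrite leq_addr.
    - by apply: leq_trans TT0; rewrite /T0 addn1 ltnS -addnA leq_addr.
    rewrite prime_coprime //; apply/negP => /dvdn_leq; rewrite absz_gt0 M0.
    by move=> /(_ isT); apply/negP; rewrite -ltnNge (leq_ltn_trans _ yp0) // leq_addl.
  rewrite (bigD1_seq d) ?mem_index_iota ?iota_uniq ?yd ?dT //= ?cd ?dz //.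
have count_le : ((\sum_(0 <= i < L) sieved S (A - M * N%:Z)%R M i)%N%:R : R) <=
    (\sum_(0 <= i < L) asbool (int_squarefree (A + M * (i%:Z - N%:Z))%R))%N%:R
     + (L%:R * y%:R^-1 + T%:R).
  apply: le_trans (_ : (\sum_(0 <= i < L)
     (asbool (int_squarefree (A + M * (i%:Z - N%:Z))%R) +
    \sum_(y.+1 <= d < T) (coprime d `|M| && ((d ^ 2)%N%:Z %| (A - M * N%:Z + M * i%:Z)%R)%Z)))%N%:R
     <= _).
    by rewrite ler_nat big_nat [leqRHS]big_nat; apply: leq_sum => i /pointwise.
  rewrite big_split /= natrD lerD2l exchange_big /= natr_sum.
  apply: le_trans (_ : \sum_(y.+1 <= d < T) (L%:R * d%:R ^- 2 + 1) <= _).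
    rewrite big_nat [leRHS]big_nat; apply: ler_sum => d /andP[yd _].
    case: (boolP (coprime d `|M|)) => [cd|_] /=; last first.
      by rewrite big1 // addr_ge0 // mulr_ge0 // invr_ge0 exprn_ge0.
    by apply: square_divisor_count => //; exact: leq_ltn_trans yd.
  rewrite big_split /= -mulr_sumr; apply: lerD.
    by rewrite ler_wpM2l // sum_inv_sqr_tail.
  by rewrite sumr_const_nat ler_nat leq_subr.
have := hC (A - M * N%:Z) M L SM; rewrite ler_norml => /andP[h _].
have LR : (K%:R : R) <= L%:R by rewrite ler_nat /L (leq_trans (leq_addr (y * T0) _)) //
    (leq_trans hN) // mul2n -addnn ltnW // ltnS leq_addr.
have L0 : 0 < L%:R :> R by rewrite ltr0n.
have yR : 0 < y%:R :> R by rewrite ltr0n.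
have TL : T%:R <= L%:R * y%:R^-1 :> R.
  by rewrite ler_pdivlMr // -natrM ler_nat mulnC.
have yL3 : L%:R * y%:R^-1 <= eps / 3 * L%:R.
  rewrite mulrC ler_wpM2r // -[leRHS]invrK lef_pV2 ?posrE ?invr_gt0 ?divr_gt0 //.
  by rewrite invf_div ltW.
have CL : C <= eps / 3 * L%:R.
  rewrite mulrC -ler_pdivrMr ?divr_gt0 // invf_div mulrA ltW //.
  exact: lt_le_trans Keps LR.
have DL := ler_wpM2r (ltW L0) Dge.
rewrite mulrBl; move: DL count_le h CL yL3 TL.
set X := 6 / _ * _; set Y := (\sum_(0 <= i < L) asbool _)%N%:R.
set Z := (\sum_(0 <= i < L) _)%N%:R; move: (sieve_density R S * L%:R) (L%:R * y%:R^-1).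
move: (T%:R : R) (X * L%:R) Y Z => a b c d e f.
have -> : eps * L%:R = eps / 3 * L%:R * 3 by field.
move: (eps / 3 * L%:R) => g; lra.
Qed.

(** * Counting the good [b], and the numerical bound *)

Lemma sum_eq_le1 (a L : nat) : (\sum_(0 <= i < L) (i == a) <= 1)%N.
Proof.
suff -> : (\sum_(0 <= i < L) (i == a) = (a < L))%N by exact: leq_b1.
elim: L => [|L IHL]; first by rewrite big_geq.
by rewrite big_nat_recr //= IHL; lia.
Qed.

(** Inclusion-exclusion for the two squarefree conditions; the 3 accounts for [b] in -1, 0, 1, that
    is, [i] in [N-1], [N], [N+1]. *)
Lemma good_count_ge (n N : nat) : (2 < n)%N ->
  (\sum_(0 <= i < (2 * N).+1) asbool (int_squarefree (0 + 1 * (i%:Z - N%:Z))%R) +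
   \sum_(0 <= i < (2 * N).+1) asbool (int_squarefree
      ((- n%:Z) ^+ n + - ((n.-1)%:Z ^+ n.-1) * (i%:Z - N%:Z))%R)
   <= count_sym (good n) N + (2 * N).+1 + 3)%N.
Proof.
move=> n2; rewrite /count_sym.
rewrite -(big_mkord xpredT (fun i => nat_of_bool (asbool (good n (i%:Z - N%:Z))))).
set L := (2 * N).+1.
apply: leq_trans (_ : (\sum_(0 <= i < L) (asbool (good n (i%:Z - N%:Z)%R) + 1 +
    ((i == N.-1) + (i == N) + (i == N.+1))) <= _)%N).
  rewrite -big_split /=; apply: leq_sum => i _.
  rewrite add0r mul1r.
  have -> : (- n%:Z) ^+ n + - (n.-1)%:Z ^+ n.-1 * (i%:Z - N%:Z) = fb_disc n (i%:Z - N%:Z).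
    by rewrite /fb_disc; ring.
  have [b1|b1] := leqP `|(i%:Z - N%:Z)%R| 1.
    have : (0 < (i == N.-1) + (i == N) + (i == N.+1))%N by lia.
    by case: asboolP; case: asboolP; lia.
  case: asboolP => [sqb|_]; last by case: asboolP; lia.
  case: asboolP => [sqD|_]; last by lia.
  by rewrite (asboolT (good_of_squarefree n2 b1 sqb sqD)); lia.
rewrite !big_split /= sum_nat_const_nat subn0 muln1 leq_add2l.
exact: (@leq_add _ _ 2 1 (@leq_add _ _ 1 1 (sum_eq_le1 _ _) (sum_eq_le1 _ _)) (sum_eq_le1 _ _)).
Qed.

(** Every Euler factor is at least 1, so the bound is at least [12 / pi^2 - 1], and [pi_lt]
    applies. *)
Lemma density_bound_gt (R : realType) n : 2158 / 10000 < density_bound R n.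
Proof.
have p0 := pi_gt0 R; have p1 := pi_lt R.
have P0 : 0 < pi ^+ 2 :> R by rewrite exprn_gt0.
have p2 : pi ^+ 2 < (1486 / 473) ^+ 2 :> R.
  by rewrite ltr_pXn2r ?nnegrE ?ltW //; lra.
have q0 : 6 / (1486 / 473) ^+ 2 < 6 / pi ^+ 2 :> R.
  by rewrite ltr_pM2l // ltf_pV2 ?posrE // exprn_gt0 //; lra.
have prod1 : 1 <= \prod_(p <- primes n.-1) (1 - 1 / (p%:R ^+ 2))^-1 :> R.
  rewrite big_seq; apply: (big_ind (fun x : R => 1 <= x)) => //.
    by move=> x y x1 y1; rewrite mulr_ege1.
  move=> p; rewrite mem_primes => /andP[/prime_gt1 pp _].
  have q1 : 1 < p%:R ^+ 2 :> R by rewrite -natrX ltr1n -(exp1n 2) ltn_exp2r.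
  have qp : 0 < (p%:R ^+ 2)^-1 :> R by rewrite invr_gt0 (lt_trans ltr01).
  have ql : (p%:R ^+ 2)^-1 < 1 :> R by rewrite invf_lt1 // (lt_trans ltr01).
  by rewrite div1r invf_ge1; lra.
have Q0 : 0 < 6 / pi ^+ 2 :> R by rewrite divr_gt0.
have := ler_wpM2l (ltW Q0) prod1; rewrite mulr1.
have : 6 * 2 / (1486 / 473) ^+ 2 > 1 + 2158 / 10000 :> R by lra.
rewrite /density_bound; clear Q0 prod1; move: (\prod_(p <- _) _) => a.
move: (6 / pi ^+ 2 : R) q0 => b.
by move: ((1486 / 473) ^+ 2 : R) => c; lra.
Qed.

Theorem theorem3p5 (R : realType) (n : nat) (hn : (2 < n)%N) :
  (forall M : nat, exists b : int, (M < `|b|)%N /\ good n b) /\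
  lower_density_ge (good n) (density_bound R n) /\
  (2158 / 10000 : R) < density_bound R n.
Proof.
have dens : lower_density_ge (good n) (density_bound R n).
  move=> eps eps0; have e3 : 0 < eps / 3 by rewrite divr_gt0.
  (* First the form [b], with no prime excluded; then [fb_disc], where the primes dividing [n-1] are
     excluded. *)
  have [||p pp|N1 h1] := @squarefree_lower_density R 0 1 1 (eps / 3) _ _ _ e3 => //.
    by rewrite dvdn1; case: eqP pp => // ->.
  have [|||N2 h2] := @squarefree_lower_density R ((- n%:Z) ^+ n)
    (- ((n.-1)%:Z ^+ n.-1)) n.-1 (eps / 3) _ _ _ e3.
  - by rewrite oppr_eq0 expf_neq0 //; lia.
  - rewrite coprimezE abszN !abszX abszN /= coprimeXl // coprimeXr //.
    by rewrite -{1}(ltn_predK hn) coprimeSn.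
  - move=> p pp; rewrite abszN abszX /= Euclid_dvdX // mem_primes pp /=.
    exact: andbC.
  (* This makes the 3 exceptional values cost at most [eps / 3] of the range. *)
  have [N3 h3] : exists N3 : nat, 9 / eps < N3%:R :> R.
    exists (Num.truncn (9 / eps)).+1.
    by have /andP[] := truncn_itv (ltW (divr_gt0 (ltr0Sn R 8) eps0)).
  exists (N1 + N2 + N3)%N => N hN.
  have := h1 N ltac:(lia); have := h2 N ltac:(lia); clear h1 h2.
  have := good_count_ge N hn; rewrite -(ler_nat R) !natrD.
  have LR : 9 / eps < (2 * N).+1%:R.
    by apply: lt_le_trans h3 _; rewrite ler_nat; lia.
  have L0 : 0 < (2 * N).+1%:R :> R by rewrite ltr0n.
  have : 3 <= eps / 3 * (2 * N).+1%:R.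
    by move: LR; rewrite ltr_pdivrMr //; lra.
  clear LR h3 hN.
  rewrite ler_pdivlMr // /density_bound big_nil mulr1.
  move: (\sum_(0 <= i < _) _)%N%:R (\sum_(0 <= i < _) _)%N%:R => X Y.
  move: (\prod_(p <- _) _) (6 / pi ^+ 2 : R) => U V.
  move: ((count_sym _ _)%:R : R) ((2 * N).+1%:R : R) => G L.
  move=> *; lra.
split; last by split => //; exact: density_bound_gt.
(* If all good [b] lay in [[-M, M]], their count would stay at most [2 M + 1], against a positive
   lower density. *)
move=> M; apply: contrapT => none.
have d0 : 0 < density_bound R n.
  by apply: lt_trans (density_bound_gt R n); lra.
have [N0 h0] := dens (density_bound R n / 2) (divr_gt0 d0 (ltr0Sn R 1)).
have small N : (count_sym (good n) N <= (2 * M).+1)%N.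
  rewrite /count_sym.
  rewrite -(big_mkord xpredT (fun i => nat_of_bool (asbool (good n (i%:Z - N%:Z))))).
  apply: leq_trans (_ : (\sum_(0 <= i < (2 * N).+1) \sum_(0 <= k < (2 * M).+1)
     (i + M == k + N) <= _)%N).
    apply: leq_sum => i _; case: asboolP => // gi.
    have iM : (`|(i%:Z - N%:Z)%R| <= M)%N.
      by rewrite leqNgt; apply/negP => iM; apply: none; exists (i%:Z - N%:Z).
    rewrite (bigD1_seq (i + M - N)%N) ?mem_index_iota ?iota_uniq //=; last by lia.
    by have -> : (i + M == i + M - N + N)%N by lia.
  rewrite exchange_big /=.
  apply: leq_trans (_ : (\sum_(0 <= k < (2 * M).+1) 1 <= _)%N).
    apply: leq_sum => k _; apply: leq_trans (sum_eq_le1 (k + N - M) (2 * N).+1).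
    by apply: leq_sum => i _; case: eqP => // e; have -> : (i == k + N - M)%N by lia.
  by rewrite sum_nat_const_nat subn0 muln1.
have [N1 h1] : exists N1 : nat, (2 * M).+1%:R * 2 / density_bound R n < N1%:R :> R.
  exists (Num.truncn ((2 * M).+1%:R * 2 / density_bound R n)).+1.
  have nn : 0 <= (2 * M).+1%:R * 2 / density_bound R n by rewrite divr_ge0 ?(ltW d0) // mulr_ge0.
  by have /andP[] := truncn_itv nn.
have := h0 (N0 + N1)%N (leq_addr _ _).
set L := (2 * (N0 + N1)).+1.
have L0 : 0 < L%:R :> R by rewrite ltr0n.
rewrite ler_pdivlMr // => h2.
have h3 : ((count_sym (good n) (N0 + N1))%:R : R) <= (2 * M).+1%:R by rewrite ler_nat.
have h4 : (N1%:R : R) <= L%:R by rewrite ler_nat /L; lia.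
have := lt_le_trans h1 h4; rewrite ltr_pdivrMr //.
by move: (density_bound R n) h2 => D h2; lra.
Qed.
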